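(* Let $\mathbb{G}$ be a graded group equipped with a homogeneous distance $d$, and let $\Sigma\subset\mathbb{G}$ be a $1$-dimensional $C^1$ smooth (embedded) submanifold. Set $q=d(\Sigma)$, the degree of $\Sigma$. Then $\Sigma$ satisfies the negligibility condition, that is, $$\mathcal{H}^q\left(\left\{x\in\Sigma:\ d_\Sigma(x)<q\right\}\right)=0 .$$
   Context: A graded group $\mathbb{G}$ of topological dimension $n$ is a simply connected nilpotent real Lie group whose Lie algebra has a grading $\mathcal{G}=V_1\oplus\cdots\oplus V_\iota$ with $[V_i,V_j]\subset V_{i+j}$ for all $i,j\ge1$, where $V_j=\{0\}$ for $j>\iota$. Dilations are defined for $r>0$ by $\delta_r(\sum_j v_j)=\sum_j r^j v_j$, $v_j\in V_j$, and are transferred to $\mathbb{G}$ by the diffeomorphism $\exp:\mathcal{G}\to\mathbb{G}$, giving group isomorphisms still denoted $\delta_r$. A homogeneous distance $d$ on $\mathbb{G}$ is a continuous distance with $d(zx,zy)=d(x,y)$ and $d(\delta_r x,\delta_r y)=r\,d(x,y)$ for all $x,y,z\in\mathbb{G}$, $r>0$. $\mathcal{H}^q$ denotes the $q$-dimensional Hausdorff measure on $\mathbb{G}$ induced by $d$. Via $\exp$, $\mathbb{G}$ is identified with the graded vector space $H_1\oplus\cdots\oplus H_\iota$, $H_j=\exp V_j$, with unit element $0$. Let $m_0=0$ and $m_j=\sum_{l=1}^j\dim H_l$. A graded basis of $\mathbb{G}$ is a basis $(e_1,\dots,e_n)$ such that $(e_{m_{j-1}+1},\dots,e_{m_j})$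 is a basis of $H_j$ for each $j=1,\dots,\iota$. The degree of $e_j$ is $d_j=k$ iff $e_j\in H_k$. $X_j$ denotes the left invariant vector field with $X_j(0)=e_j$. Degree: for a $1$-dimensional submanifold $\Sigma$, $x\in\Sigma$ and $\tau\in T_x\Sigma\setminus\{0\}$, write $\tau=\sum_{j=1}^n\lambda_j X_j(x)$. The pointwise degree is $d_\Sigma(x)=\max\{d_j:\lambda_j\ne0\}$, and the degree of $\Sigma$ is $d(\Sigma)=\max_{x\in\Sigma}d_\Sigma(x)$. *)

(* Defs.v *)
From HB Require Import structures.
From mathcomp Require Import all_boot all_order all_algebra.
From mathcomp Require Import all_classical all_reals all_analysis.

Set Implicit Arguments.
Unset Strict Implicit.
Unset Printing Implicit Defensive.

Import Order.TTheory GRing.Theory Num.Theory.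
Import numFieldNormedType.Exports.

Local Open Scope classical_set_scope.
Local Open Scope ring_scope.

(** * The group law in exponential coordinates *)

(* Right-nested bracket [x_1, [x_2, ... [x_(m-1), x_m]]] of a word x_1 ... x_m. *)
Fixpoint nested_bracket (V : nmodType) (br : V -> V -> V) (w : seq V) : V :=
  match w with
  | [::] => 0
  | [:: x] => x
  | x :: w' => br x (nested_bracket br w')
  end.

(* Dynkin's form of the Baker-Campbell-Hausdorff series,
     sum_(k >= 1) (-1)^(k-1)/k sum_(r_i + s_i > 0)
       [x^r_1 y^s_1 ... x^r_k y^s_k]
         / ((r_1 + s_1 + ... + r_k + s_k) r_1! s_1! ... r_k! s_k!).
   It is truncated to k, r_i, s_i <= s: when all brackets of more than s
   elements vanish, the omitted terms are zero, so that this is the full series.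
   The exponents (r_i, s_i) are encoded as p i, and k is shifted by one. *)
Definition BCH (R : realType) (V : lmodType R) (br : V -> V -> V) (s : nat)
    (x y : V) : V :=
  \sum_(k < s)
    \sum_(p : {ffun 'I_k.+1 -> 'I_s.+1 * 'I_s.+1} |
            [forall i, (0 < (p i).1 + (p i).2)%N])
      ((- 1) ^+ k / k.+1%:R
       / (\sum_(i < k.+1) ((p i).1 + (p i).2))%N%:R
       / \prod_(i < k.+1) (((p i).1)`! * ((p i).2)`!)%N%:R) *:
      nested_bracket br
        (flatten [seq nseq (p i).1 x ++ nseq (p i).2 y | i <- enum 'I_k.+1]).

(* A simply connected nilpotent Lie group is diffeomorphic to its Lie algebra
   via exp; here both are carried by 'rV[R]_n, exp being the identity, so that
   the group law is the Baker-Campbell-Hausdorff product, the unit is 0 and the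
   inverse is the opposite.  The Lie algebra is nilpotent because of its
   grading.  Layer 0 is set to 0 by convention; the layers of the grading are
   those of index 1, ..., gg_step. *)
Record gradedGroup (R : realType) (n : nat) := GradedGroup {
  gg_step : nat ;
  gg_layer : nat -> {vspace 'rV[R]_n} ;
  gg_bracket : 'rV[R]_n -> 'rV[R]_n -> 'rV[R]_n ;
  gg_op : 'rV[R]_n -> 'rV[R]_n -> 'rV[R]_n ;
  gg_bracket_linear : forall (a : R) (x y z : 'rV[R]_n),
    gg_bracket (a *: x + y) z = a *: gg_bracket x z + gg_bracket y z ;
  gg_bracket_anti : forall x y, gg_bracket x y = - gg_bracket y x ;
  gg_jacobi : forall x y z,
    gg_bracket x (gg_bracket y z) + gg_bracket y (gg_bracket z x)
      + gg_bracket z (gg_bracket x y) = 0 ;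
  gg_layer_eq0 : forall j : nat, (j == 0%N) || (gg_step < j)%N ->
    gg_layer j = 0%VS ;
  gg_layer_sum : (\sum_(j < gg_step.+1) gg_layer j = fullv)%VS ;
  gg_layer_direct : directv (\sum_(j < gg_step.+1) gg_layer j)%VS ;
  gg_graded : forall i j x y, (1 <= i)%N -> (1 <= j)%N ->
    x \in gg_layer i -> y \in gg_layer j ->
    gg_bracket x y \in gg_layer (i + j) ;
  gg_opA : forall x y z, gg_op x (gg_op y z) = gg_op (gg_op x y) z ;
  gg_op0x : forall x, gg_op 0 x = x ;
  gg_opx0 : forall x, gg_op x 0 = x ;
  gg_opNx : forall x : 'rV[R]_n, gg_op (- x) x = 0 ;
  gg_opxN : forall x : 'rV[R]_n, gg_op x (- x) = 0 ;
  gg_opE : forall x y, gg_op x y = BCH gg_bracket gg_step x y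
}.

Definition dilation (R : realType) (n : nat) (G : gradedGroup R n) (r : R)
    (x : 'rV[R]_n) : 'rV[R]_n :=
  \sum_(j < (gg_step G).+1)
    r ^+ j *: sumv_pi (\sum_(j < (gg_step G).+1) gg_layer G j)%VS j x.

Record homogeneous_distance (R : realType) (n : nat) (G : gradedGroup R n)
    (d : 'rV[R]_n -> 'rV[R]_n -> R) : Prop := HomogeneousDistance {
  hd_eq0 : forall x y, d x y = 0 <-> x = y ;
  hd_sym : forall x y, d x y = d y x ;
  hd_triangle : forall x y z, d x z <= d x y + d y z ;
  hd_continuous : continuous (fun p : 'rV[R]_n * 'rV[R]_n => d p.1 p.2) ;
  hd_left_invariant : forall x y z, d (gg_op G z x) (gg_op G z y) = d x y ;
  hd_homogeneous : forall (x y : 'rV[R]_n) (r : R), 0 < r ->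
    d (dilation G r x) (dilation G r y) = r * d x y
}.

(** * Hausdorff measure of a distance *)

Section Hausdorff.
Context (R : realType) (T : Type) (d : T -> T -> R).
Local Open Scope ereal_scope.

Definition diameter (A : set T) : \bar R :=
  ereal_sup [set (d p.1 p.2)%:E | p in A `*` A].

(* diam(A)^s, with the usual conventions: 0 for the empty set, and 1 for
   nonempty bounded sets when s = 0. *)
Definition hausdorff_gauge (s : R) (A : set T) : \bar R :=
  if A == set0 then 0 else poweR (diameter A) s.

Definition hausdorff_content (s delta : R) (A : set T) : \bar R :=
  ereal_inf [set \sum_(0 <= i <oo) hausdorff_gauge s (S i) |
    S in [set S : nat -> set T |
      A `<=` \bigcup_i S i /\ forall i, diameter (S i) <= delta%:E]].

(* s-dimensional Hausdorff measure, with normalizing constant 1. *)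
Definition hausdorff_measure (s : R) (A : set T) : \bar R :=
  ereal_sup [set hausdorff_content s delta A |
    delta in [set delta : R | (0 < delta)%R]].

End Hausdorff.

(** * One-dimensional C^1 submanifolds *)

Section Curves.
Context (R : realType) (n : nat).

Definition C1_on (a b : R) (c : R -> 'rV[R]_n) : Prop :=
  forall t, t \in `]a, b[%R ->
    derivable c t 1 /\ {for t, continuous (derive1 c)}.

(* c is a regular C^1 parametrization of Sigma `&` U, and a homeomorphism from
   ]a, b[ onto Sigma `&` U with the induced topology. *)
Definition local_parametrization (Sigma U : set 'rV[R]_n) (a b : R)
    (c : R -> 'rV[R]_n) : Prop :=
  [/\ C1_on a b c,
      forall t, t \in `]a, b[%R -> derive1 c t != 0,
      {in `]a, b[%R &, injective c},
      c @` `]a, b[ = Sigma `&` U &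
      forall J : set R, open J -> exists2 W : set 'rV[R]_n,
        open W & c @` (`]a, b[ `&` J) = (Sigma `&` U) `&` W].

Definition C1_submanifold1 (Sigma : set 'rV[R]_n) : Prop :=
  forall x, Sigma x -> exists U : set 'rV[R]_n, exists a b : R,
    exists c : R -> 'rV[R]_n,
      [/\ open U, U x, a < b & local_parametrization Sigma U a b c].

Definition tangent_space (Sigma : set 'rV[R]_n) (x : 'rV[R]_n)
    : set 'rV[R]_n :=
  [set tau | exists eps : R, exists c : R -> 'rV[R]_n,
    [/\ 0 < eps, C1_on (- eps) eps c,
        forall t, t \in `]- eps, eps[%R -> Sigma (c t),
        c 0 = x & derive1 c 0 = tau]].

End Curves.

(** * Graded bases and degrees *)

Section Degree.
Context (R : realType) (n : nat) (G : gradedGroup R n).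

Definition layer_offset (j : nat) : nat :=
  (\sum_(1 <= l < j.+1) \dim (gg_layer G l))%N.

Definition graded_basis (e : n.-tuple 'rV[R]_n) : Prop :=
  basis_of fullv e /\
  forall j, (1 <= j <= gg_step G)%N ->
    basis_of (gg_layer G j)
      (take (\dim (gg_layer G j)) (drop (layer_offset j.-1) e)).

Variable e : n.-tuple 'rV[R]_n.

(* The unique k such that e_j lies in the k-th layer. *)
Definition basis_degree (j : 'I_n) : nat :=
  \max_(k < (gg_step G).+1 | tnth e j \in gg_layer G k) k.

(* X_j(x), the image of e_j under the differential at 0 of the left
   translation by x. *)
Definition left_invariant_field (j : 'I_n) (x : 'rV[R]_n) : 'rV[R]_n :=
  'D_(tnth e j) (gg_op G x) 0.

(* lambda_j, where tau = \sum_j lambda_j X_j(x). *)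
Definition field_coord (x tau : 'rV[R]_n) (j : 'I_n) : R :=
  coord [tuple left_invariant_field k x | k < n] j tau.

Definition vector_degree (x tau : 'rV[R]_n) : nat :=
  \max_(j < n | field_coord x tau j != 0) basis_degree j.

(* The tangent spaces being lines, the choice of tau is immaterial. *)
Definition pointwise_degree (Sigma : set 'rV[R]_n) (x : 'rV[R]_n) : nat :=
  vector_degree x (xget 0 [set tau | tangent_space Sigma x tau /\ tau != 0]).

(* Pointwise degrees are at most gg_step G, so this is their maximum on Sigma
   (and 0 if Sigma is empty). *)
Definition degree (Sigma : set 'rV[R]_n) : nat :=
  \max_(k < (gg_step G).+1 |
          `[< exists2 x, Sigma x & pointwise_degree Sigma x = k >]) k.

End Degree.

(* Main.v *)
Require Import Defs.
From HB Require Import structures.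
From mathcomp Require Import all_boot all_order all_algebra.
From mathcomp Require Import all_classical all_reals all_analysis.
From mathcomp Require Import lra.
Import numFieldNormedType.Exports.
Local Open Scope classical_set_scope.
Local Open Scope ring_scope.

Set Implicit Arguments.
Unset Strict Implicit.
Unset Printing Implicit Defensive.

Import Order.TTheory GRing.Theory Num.Theory.

(** Write a parametrization of [Sigma] as [c], and let
    [lambda t = 'D_(c'(t)) (op (- c t)) (c t)] be its velocity translated back
    to the unit (the left Maurer-Cartan form).  The coordinates of [c' t] in the
    left invariant frame are those of [lambda t] in the graded basis
    ([field_coordE]), so that the degree of [Sigma] at [c t] is read on the
    layers of [lambda t]: with [q] the degree of [Sigma], the layers of
    index [> q] of [lambda] vanish identically, and those of index [>= q] vanish
    at [s] when [c s] has degree [< q].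

    The heart of the proof is that chords issued from such a point are short:
    [d (c s) (c t) <= eps * rho] as soon as [s <= t <= s + rho ^+ q] and [rho]
    is small ([low_degree_chord]).  By left invariance and homogeneity the
    distance is [rho * d 0 (z t)], where [z] is the curve [op (- c s) (c u)]
    dilated by [1 / rho].  Dilations are group automorphisms, so [z] satisfies
    [z' u = 'D_(mu u) (op (z u)) 0] where [mu u] is [lambda u] dilated by
    [1 / rho].  On a time interval of length [rho ^+ q], the layer [l] of
    [lambda] contributes at most [rho ^+ (q - l) * `|lambda_l|] to the motion
    of [z]: this is [O(rho)] for [l < q], it is [o(1)] for [l = q] because
    [lambda_q] is continuous and vanishes at [s], and it is [0] for [l > q]
    ([low_degree_velocity]).  Hence [z] stays close to [0] ([small_velocity]),
    and so does [d 0 (z t)].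

    By compactness this is uniform on segments.  Cutting a segment of length
    [L] into about [L / rho ^+ q] cells of length [rho ^+ q] covers the points
    of low degree by sets of diameter at most [eps * rho], and the sum of the
    [q]-th powers of the diameters is about [L * eps ^+ q], which is arbitrarily
    small ([hausdorff_null_curve]).  A Lindelof argument
    ([hausdorff_null_local]) passes from charts to [Sigma].

    The smoothness of the group law and its compatibility with dilations hold
    for every expression formed with sums, scalars and brackets, of which the
    truncated Baker-Campbell-Hausdorff series is an instance
    ([lie_poly_BCH]). *)

(** * Derivatives of curves, linear and bilinear maps *)

Section Derivatives.
Context (R : realType) (V W : normedModType R).

Lemma is_deriveP (f : V -> W) (a v : V) (l : W) :
  is_derive a v f l <->
  h^-1 *: (f (h *: v + a) - f a) @[h --> 0^'] --> l.
Proof.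
split=> [[df <-]|fl]; first exact: df.
by apply: DeriveDef; [apply/cvg_ex; exists l|exact/cvg_lim].
Qed.

Lemma is_derive_continuous (f : R -> W) (t : R) (l : W) :
  is_derive t 1 f l -> f x @[x --> t] --> f t.
Proof. by move=> [/derivable1_diffP/differentiable_continuous]. Qed.

End Derivatives.

Lemma is_derive_line (R : realType) (W : normedModType R) (b v : W) :
  is_derive (0 : R) 1 (fun h : R => b + h *: v) v.
Proof.
apply/is_deriveP.
apply: (@cvg_trans _ (cst v @ (0 : R)^')); last exact: cvg_cst.
apply: near_eq_cvg; near=> h.
rewrite addr0 scale0r addr0 addrC addKr [_%:A]mulr1 scalerA mulVf ?scale1r //.
by near: h; exact: nbhs_dnbhs_neq.
Unshelve. all: by end_near. Qed.

Section Bilinear.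
Context (R : realType) (n : nat).
Local Notation V := 'rV[R]_n.

Lemma linear_funB (U W : lmodType R) (f : U -> W) : linear f ->
  {morph f : x y / x - y}.
Proof. by move=> fl x y; rewrite addrC -scaleN1r fl scaleN1r addrC. Qed.

Lemma linear_fun0 (U W : lmodType R) (f : U -> W) : linear f -> f 0 = 0.
Proof. by move=> fl; rewrite -[X in f X](subrr 0) (linear_funB fl) subrr. Qed.

Lemma linear_funZ (U W : lmodType R) (f : U -> W) : linear f ->
  forall k, {morph f : x / k *: x}.
Proof. by move=> fl k x; rewrite -[k *: x]addr0 fl (linear_fun0 fl) addr0. Qed.

Lemma linear_expand (W : lmodType R) (f : V -> W) : linear f ->
  forall x, f x = \sum_i x 0 i *: f (delta_mx 0 i).
Proof.
move=> fl x.
pose flM := GRing.isLinear.Build R V W *:%R f fl.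
pose f' : {linear V -> W} := HB.pack f flM.
rewrite {1}(row_sum_delta x) -[f]/(f' : V -> W) linear_sum.
by apply: eq_bigr => i _; rewrite linearZ.
Qed.

Lemma cvg_sumr (W : normedModType R) (I : Type) (r : seq I) (P : pred I)
    (T : Type) (F : set_system T) {FF : Filter F}
    (f : I -> T -> W) (a : I -> W) :
  (forall i, P i -> f i @ F --> a i) ->
  \sum_(i <- r | P i) f i t @[t --> F] --> \sum_(i <- r | P i) a i.
Proof. by apply: cvg_big => //; exact: add_continuous. Qed.

Lemma cvg_coord (T : Type) (F : set_system T) {FF : Filter F} (g : T -> V)
    (a : V) i :
  g @ F --> a -> g t 0 i @[t --> F] --> a 0 i.
Proof.
move=> ga.
exact: (@continuous_cvg _ V R^o F FF g (fun M : V => M 0 i) a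
  (@coord_continuous R 1 n 0 i a) ga).
Qed.

Lemma cvg_linear (m : nat) (f : V -> 'rV[R]_m) (T : Type) (F : set_system T)
    {FF : Filter F} (g : T -> V) (a : V) : linear f ->
  g @ F --> a -> f (g t) @[t --> F] --> f a.
Proof.
move=> fl ga; under eq_fun do rewrite (linear_expand fl).
rewrite (linear_expand fl a).
apply: cvg_sumr => i _; apply: cvgZr_tmp.
exact: cvg_coord.
Qed.

Lemma is_derive_linear (m : nat) (f : V -> 'rV[R]_m) (c : R -> V) (t : R)
    (c' : V) :
  linear f -> is_derive t 1 c c' -> is_derive t 1 (f \o c) (f c').
Proof.
move=> fl /is_deriveP dc; apply/is_deriveP.
rewrite (_ : (fun h : R => _) = (fun h => f (h^-1 *: (c (h *: 1 + t) - c t)))).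
  exact: cvg_linear.
by apply/funext => h /=; rewrite (linear_funZ fl) (linear_funB fl).
Qed.

Variable br : V -> V -> V.
Hypothesis brl : forall a x y z, br (a *: x + y) z = a *: br x z + br y z.
Hypothesis bra : forall x y, br x y = - br y x.

Lemma brr a x y z : br z (a *: x + y) = a *: br z x + br z y.
Proof. by rewrite bra brl opprD -scalerN -!bra. Qed.

Let brl' y : linear (br^~ y). Proof. by move=> c u v; exact: brl. Qed.
Let brr' y : linear (br y). Proof. by move=> c u v; exact: brr. Qed.

(** Bilinear maps in finite dimension are continuous, being combinations of
    products of coordinates. *)
Lemma cvg_br (T : Type) (F : set_system T) {FF : Filter F} (f g : T -> V)
    (a b : V) :
  f @ F --> a -> g @ F --> b -> br (f t) (g t) @[t --> F] --> br a b.
Proof.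
move=> fa gb.
have E x y : br x y = \sum_i \sum_j
    (x 0 i * y 0 j) *: br (delta_mx 0 i) (delta_mx 0 j).
  rewrite (linear_expand (f := br^~ y)) //; apply: eq_bigr => i _.
  rewrite (linear_expand (f := br _)); last by move=> c u v; exact: brr.
  by rewrite scaler_sumr; apply: eq_bigr => j _; rewrite scalerA.
under eq_fun do rewrite E.
rewrite E; apply: cvg_sumr => i _; apply: cvg_sumr => j _; apply: cvgZr_tmp.
apply: cvgM.
  exact: cvg_coord.
exact: cvg_coord.
Qed.

Lemma is_derive_br (f g : R -> V) (t : R) (f' g' : V) :
  is_derive t 1 f f' -> is_derive t 1 g g' ->
  is_derive t 1 (fun h => br (f h) (g h)) (br f' (g t) + br (f t) g').
Proof.
move=> df dg; apply/is_deriveP.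
have gc : g (h *: 1 + t) @[h --> 0^'] --> g t.
  apply: (cvg_comp (fun h : R => h *: 1 + t) g);
    last exact: is_derive_continuous dg.
  have : h *: 1 + t @[h --> (0 : R)^'] --> 0 *: 1 + t.
    apply: cvg_within_filter; apply: cvgD; last exact: cvg_cst.
    by apply: cvgZr_tmp; exact: cvg_id.
  by rewrite scale0r add0r.
have df' := (is_deriveP _ _ _ _).1 df.
have dg' := (is_deriveP _ _ _ _).1 dg.
rewrite (_ : (fun h : R => _) = (fun h =>
    br (h^-1 *: (f (h *: 1 + t) - f t)) (g (h *: 1 + t)) +
    br (f t) (h^-1 *: (g (h *: 1 + t) - g t)))).
  by apply: cvgD; apply: cvg_br => //; exact: cvg_cst.
apply/funext => h.
rewrite (linear_funZ (brl' _)) (linear_funZ (brr' _)) -scalerDr.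
by rewrite (linear_funB (brl' _)) (linear_funB (brr' _)) addrA subrK.
Qed.

End Bilinear.

(** * Lie polynomials *)

Section LiePolynomials.
Context (R : realType) (n : nat).
Local Notation V := 'rV[R]_n.
Variable br : V -> V -> V.
Hypothesis brl : forall a x y z, br (a *: x + y) z = a *: br x z + br y z.
Hypothesis bra : forall x y, br x y = - br y x.

(** Functions of two vectors built from the vector space operations and the
    bracket.  They are singled out because what is needed of the group law
    (continuity, differentiability, compatibility with Lie algebra
    endomorphisms) passes to sums and brackets by an immediate induction. *)
Inductive lie_poly : (V -> V -> V) -> Prop :=
| lie_poly0 : lie_poly (fun _ _ => 0)
| lie_poly_fst : lie_poly (fun x _ => x)
| lie_poly_snd : lie_poly (fun _ y => y)
| lie_poly_lin k P Q : lie_poly P -> lie_poly Q ->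
    lie_poly (fun x y => k *: P x y + Q x y)
| lie_poly_br P Q : lie_poly P -> lie_poly Q ->
    lie_poly (fun x y => br (P x y) (Q x y)).

Lemma lie_poly_sum (I : Type) (r : seq I) (C : pred I) (k : I -> R)
    (P : I -> V -> V -> V) : (forall i, lie_poly (P i)) ->
  lie_poly (fun x y => \sum_(i <- r | C i) k i *: P i x y).
Proof.
move=> lP; elim: r => [|i r ih].
  rewrite (_ : (fun _ _ => _) = fun _ _ => 0); first exact: lie_poly0.
  by apply/funext => x; apply/funext => y; rewrite big_nil.
rewrite (_ : (fun _ _ => _) = fun x y =>
  (if C i then k i else 0) *: P i x y + \sum_(i <- r | C i) k i *: P i x y).
  exact: lie_poly_lin.
apply/funext => x; apply/funext => y; rewrite big_cons.
by case: ifP; rewrite ?scale0r ?add0r.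
Qed.

(** Words in the letters [x] (false) and [y] (true). *)
Lemma lie_poly_word (w : seq bool) :
  lie_poly (fun x y => nested_bracket br [seq if b then y else x | b <- w]).
Proof.
have letter b : lie_poly (fun x y => if b then y else x).
  by case: b; [exact: lie_poly_snd|exact: lie_poly_fst].
elim: w => [|b [|b' w] ih] /=; [exact: lie_poly0|exact: letter|].
exact: lie_poly_br (letter b) ih.
Qed.

(** Each exponent sequence [p] spells one word, on which the bracket is
    iterated. *)
Lemma lie_poly_BCH s : lie_poly (BCH br s).
Proof.
rewrite (_ : BCH br s = fun x y => \sum_(k < s) 1 *:
    \sum_(p : {ffun 'I_k.+1 -> 'I_s.+1 * 'I_s.+1} |
            [forall i, (0 < (p i).1 + (p i).2)%N])
      ((- 1) ^+ k / k.+1%:R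
       / (\sum_(i < k.+1) ((p i).1 + (p i).2))%N%:R
       / \prod_(i < k.+1) (((p i).1)`! * ((p i).2)`!)%N%:R) *:
      nested_bracket br [seq if b then y else x | b <-
        flatten [seq nseq (p i).1 false ++ nseq (p i).2 true |
          i <- enum 'I_k.+1]]).
  apply: (@lie_poly_sum _ _ _ (fun=> 1)) => k; apply: lie_poly_sum => p.
  exact: lie_poly_word.
apply/funext => x; apply/funext => y; apply: eq_bigr => k _; rewrite scale1r.
apply: eq_bigr => p _; congr (_ *: nested_bracket _ _).
rewrite map_flatten -map_comp; congr flatten; apply: eq_map => i /=.
by rewrite map_cat !map_nseq.
Qed.

Lemma lie_poly_cvg P : lie_poly P ->
  forall (T : Type) (F : set_system T) {FF : Filter F} (f g : T -> V) (a b : V),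
  f @ F --> a -> g @ F --> b -> P (f t) (g t) @[t --> F] --> P a b.
Proof.
move=> lP T F FF f g a b fa gb.
elim: lP => {P} [||| k P Q _ Pc _ Qc | P Q _ Pc _ Qc] //.
- exact: cvg_cst.
- by apply: cvgD => //; apply: cvgZl_tmp.
- exact: cvg_br.
Qed.

Lemma lie_poly_morph P (h : V -> V) : lie_poly P -> linear h ->
  (forall x y, h (br x y) = br (h x) (h y)) ->
  forall x y, h (P x y) = P (h x) (h y).
Proof.
move=> lP hl hbr x y.
elim: lP => {P} [||| k P Q _ Ph _ Qh | P Q _ Ph _ Qh] //.
  exact: linear_fun0.
  by rewrite hl Ph Qh.
by rewrite hbr Ph Qh.
Qed.

(** The partial differential [D a b] of [P a] at [b] is built by induction,
    with [lie_poly_br] handled by the Leibniz rule.  Differentiability is stated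
    along curves, which is the chain rule in the form used below. *)
Lemma lie_poly_partial P : lie_poly P -> exists D : V -> V -> V -> V,
  [/\ forall a b, linear (D a b),
      forall (T : Type) (F : set_system T) {FF : Filter F} (f g k : T -> V)
        (a b v : V),
        f @ F --> a -> g @ F --> b -> k @ F --> v ->
        D (f t) (g t) (k t) @[t --> F] --> D a b v &
      forall (a : V) (c : R -> V) (t : R) (c' : V), is_derive t 1 c c' ->
        is_derive t 1 (fun h => P a (c h)) (D a (c t) c')].
Proof.
have brr := brr brl bra.
elim=> {P} [||| k P Q lP [D1 [l1 c1 d1]] lQ [D2 [l2 c2 d2]]
  | P Q lP [D1 [l1 c1 d1]] lQ [D2 [l2 c2 d2]]].
- exists (fun _ _ _ => 0); split=> *; [|exact: cvg_cst|exact: is_derive_cst].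
  by move=> k x y; rewrite scaler0 addr0.
- exists (fun _ _ _ => 0); split=> *; [|exact: cvg_cst|exact: is_derive_cst].
  by move=> k x y; rewrite scaler0 addr0.
- by exists (fun _ _ v => v); split.
- exists (fun a b v => k *: D1 a b v + D2 a b v); split.
  + move=> a b m x y; rewrite l1 l2 !scalerDr !scalerA mulrC !addrA.
    by congr (_ + _); rewrite addrAC.
  + move=> *; apply: cvgD; last exact: c2.
    by apply: cvgZl_tmp; exact: c1.
  + move=> a c t c' dc.
    exact: (is_deriveD (is_deriveZ k (d1 a _ _ _ dc)) (d2 a _ _ _ dc)).
- exists (fun a b v => br (D1 a b v) (Q a b) + br (P a b) (D2 a b v)); split.
  + move=> a b m x y; rewrite l1 l2 brl brr !scalerDr !addrA; congr (_ + _).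
    by rewrite addrAC.
  + move=> *; apply: cvgD; apply: cvg_br => //;
      by [exact: c1|exact: c2|exact: lie_poly_cvg].
  + move=> a c t c' dc.
    exact: (is_derive_br brl bra (d1 _ _ _ _ dc) (d2 _ _ _ _ dc)).
Qed.

Section Derivative.
Variable P : V -> V -> V.
Hypothesis lP : lie_poly P.

(* Differentiability along the lines [b + h *: v] identifies [D a b v] with the
   directional derivative ['D_v (P a) b]. *)
Let partial_eq D :
  (forall (a : V) (c : R -> V) (t : R) (c' : V), is_derive t 1 c c' ->
        is_derive t 1 (fun h => P a (c h)) (D a (c t) c')) ->
  forall a b v, 'D_v (P a) b = D a b v.
Proof.
move=> dD a b v.
have /is_deriveP := dD a _ _ _ (is_derive_line b v).
rewrite scale0r addr0 => dP.
suff : is_derive b v (P a) (D a b v) by case.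
apply/is_deriveP; move: dP; apply: cvg_trans; apply: near_eq_cvg; near=> h.
by rewrite addr0 [_%:A]mulr1 [b + _]addrC.
Unshelve. all: by end_near. Qed.

Lemma lie_poly_derive_linear a b : linear (fun v => 'D_v (P a) b).
Proof.
have [D [lD _ dD]] := lie_poly_partial lP.
by move=> k u v; rewrite !(partial_eq dD) lD.
Qed.

Lemma lie_poly_derive_cvg (T : Type) (F : set_system T) {FF : Filter F}
    (f g k : T -> V) (a b v : V) :
  f @ F --> a -> g @ F --> b -> k @ F --> v ->
  'D_(k t) (P (f t)) (g t) @[t --> F] --> 'D_v (P a) b.
Proof.
move=> fa gb kv; have [D [_ cD dD]] := lie_poly_partial lP.
rewrite (partial_eq dD); under eq_fun do rewrite (partial_eq dD).
exact: cD.
Qed.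

Lemma lie_poly_is_derive (a : V) (c : R -> V) (t : R) (c' : V) :
  is_derive t 1 c c' ->
  is_derive t 1 (fun h => P a (c h)) ('D_c' (P a) (c t)).
Proof.
move=> dc; have [D [_ _ dD]] := lie_poly_partial lP.
by rewrite (partial_eq dD); exact: dD.
Qed.

End Derivative.
End LiePolynomials.

(** * Dilations and the Maurer-Cartan form of a graded group *)

Section GradedGroup.
Context (R : realType) (n : nat) (G : gradedGroup R n).
Local Notation V := 'rV[R]_n.
Local Notation op := (gg_op G).
Local Notation br := (gg_bracket G).
Local Notation step := (gg_step G).

Let brl := gg_bracket_linear G.
Let bra := gg_bracket_anti G.
Let brr := brr brl bra.

Lemma lie_poly_op : lie_poly br op.
Proof.
rewrite (_ : op = BCH br step); first exact: lie_poly_BCH.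
by apply/funext => x; apply/funext => y; exact: gg_opE.
Qed.

Definition layer_proj (l : 'I_step.+1) (x : V) : V :=
  sumv_pi (\sum_(j < step.+1) gg_layer G j)%VS l x.

Lemma dilationE r x : dilation G r x =
  \sum_(j < step.+1) r ^+ j *: layer_proj j x.
Proof. by []. Qed.

Lemma layer_proj_linear l : linear (layer_proj l).
Proof. by move=> k x y; rewrite /layer_proj linearP. Qed.

Lemma layer_proj_mem l x : layer_proj l x \in gg_layer G l.
Proof. exact: memv_sum_pi. Qed.

Lemma layer_proj_sum x : \sum_l layer_proj l x = x.
Proof. by apply: sumv_pi_sum; rewrite gg_layer_sum memvf. Qed.

(** The sum of the layers being direct, the decomposition of a vector along
    them is unique. *)
Lemma layer_proj_id (k l : 'I_step.+1) x : x \in gg_layer G k ->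
  layer_proj l x = if l == k then x else 0.
Proof.
move=> xk.
have /directv_sum_unique := gg_layer_direct G.
move=> /(_ (layer_proj^~ x) (fun l => if l == k then x else 0)) H.
have /H : forall i : 'I_step.+1, true -> layer_proj i x \in gg_layer G i.
  by move=> i _; exact: layer_proj_mem.
have Q : forall i : 'I_step.+1, true ->
    (if i == k then x else 0) \in gg_layer G i.
  by move=> i _; case: eqP => [->//|_]; exact: mem0v.
move=> /(_ Q); rewrite layer_proj_sum -big_mkcond big_pred1_eq eqxx.
by move=> /esym/forall_inP/(_ l isT)/eqP.
Qed.

Lemma layer_gt_step k x : (step < k)%N -> x \in gg_layer G k -> x = 0.
Proof.
by move=> h; rewrite gg_layer_eq0 ?h ?orbT// memv0 => /eqP.
Qed.

Lemma layer_proj0 (l : 'I_step.+1) x : l = 0%N :> nat -> layer_proj l x = 0.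
Proof.
move=> l0; have := layer_proj_mem l x.
by rewrite gg_layer_eq0 ?l0// memv0 => /eqP.
Qed.

Lemma dilation_linear r : linear (dilation G r).
Proof.
move=> k x y; rewrite !dilationE scaler_sumr -big_split.
apply: eq_bigr => j _ /=.
by rewrite layer_proj_linear scalerDr !scalerA mulrC.
Qed.

Lemma dilation_layer r k x : x \in gg_layer G k -> dilation G r x = r ^+ k *: x.
Proof.
move=> xk; have [ks|ks] := leqP k step; last first.
  by rewrite (layer_gt_step ks xk) (linear_fun0 (dilation_linear r)) scaler0.
rewrite -ltnS in ks; pose k' := Ordinal ks.
have xk' : x \in gg_layer G k' by [].
rewrite dilationE (bigD1 k') //= big1 => [|i /negPf ik].
  by rewrite addr0 (layer_proj_id _ xk') eqxx.
by rewrite (layer_proj_id _ xk') ik scaler0.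
Qed.

(** Both sides are sums over pairs of layers, and the bracket of the layers [i]
    and [j] lies in the layer [i + j], on which the dilation is the
    multiplication by [r ^+ i * r ^+ j].  The layer [0], to which the grading
    condition does not apply, is zero. *)
Lemma dilation_bracket r x y :
  dilation G r (br x y) = br (dilation G r x) (dilation G r y).
Proof.
have brrl z : linear (br z) by move=> c u v; exact: brr.
have brll z : linear (br^~ z) by move=> c u v; exact: brl.
have dl := dilation_linear r.
have sumL (f : V -> V) (I : finType) (g : I -> V) : linear f ->
    f (\sum_i g i) = \sum_i f (g i).
  move=> fl; elim/big_rec2 : _ => [|i u v _ <-]; first exact: linear_fun0.
  by rewrite -[g i]scale1r fl !scale1r.
rewrite -[x in LHS]layer_proj_sum -[y in LHS]layer_proj_sum.
rewrite (sumL (br^~ _)) // (sumL (dilation G r)) // (dilationE r x).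
rewrite (sumL (br^~ _)) //; apply: eq_bigr => i _.
rewrite (sumL (br _)) // (sumL (dilation G r)) // (dilationE r y).
rewrite (sumL (br _)) //; apply: eq_bigr => j _.
rewrite (linear_funZ (brll _)) (linear_funZ (brrl _)) scalerA -exprD.
have [i0|i0] := posnP i.
  by rewrite layer_proj0 // (linear_fun0 (brll _)) linear_fun0 // scaler0.
have [j0|j0] := posnP j.
  rewrite (layer_proj0 (l := j)) // (linear_fun0 (brrl _)) linear_fun0 //.
  by rewrite scaler0.
by apply: dilation_layer; apply: gg_graded; rewrite ?layer_proj_mem.
Qed.

Lemma dilation_op r x y :
  dilation G r (op x y) = op (dilation G r x) (dilation G r y).
Proof.
apply: (lie_poly_morph lie_poly_op (dilation_linear r)).
exact: dilation_bracket.
Qed.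

Lemma op_derive_linear a b : linear (fun v => 'D_v (op a) b).
Proof. exact: (lie_poly_derive_linear brl bra lie_poly_op). Qed.

Lemma op_derive_cvg (T : Type) (F : set_system T) {FF : Filter F}
    (f g k : T -> V) (a b v : V) :
  f @ F --> a -> g @ F --> b -> k @ F --> v ->
  'D_(k t) (op (f t)) (g t) @[t --> F] --> 'D_v (op a) b.
Proof. exact: (lie_poly_derive_cvg brl bra lie_poly_op). Qed.

Lemma op_is_derive (a : V) (c : R -> V) (t : R) (c' : V) :
  is_derive t 1 c c' ->
  is_derive t 1 (fun h => op a (c h)) ('D_c' (op a) (c t)).
Proof. exact: (lie_poly_is_derive brl bra lie_poly_op). Qed.

(** Both sides are the velocity at [0] of the dilation of the curve
    [op a (b + h *: v)]. *)
Lemma dilation_derive r a b v : dilation G r ('D_v (op a) b) =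
  'D_(dilation G r v) (op (dilation G r a)) (dilation G r b).
Proof.
have dl := dilation_linear r.
have /(op_is_derive a) := is_derive_line b v.
move=> /(is_derive_linear dl) [_]; rewrite scale0r addr0 => <-.
have /(op_is_derive (dilation G r a)) :=
  is_derive_linear dl (is_derive_line b v).
move=> [_]; rewrite /= scale0r addr0 => <-.
by congr (derive _ (0 : R) (1 : R)); apply/funext => h /=; rewrite dilation_op.
Qed.

Lemma opVK a x : op a (op (- a) x) = x.
Proof. by rewrite gg_opA gg_opxN gg_op0x. Qed.

(** The left Maurer-Cartan form: the tangent vector [tau] at [x], moved to the
    unit by the left translation by [- x]. *)
Definition maurer_cartan (x tau : V) : V := 'D_tau (op (- x)) x.

(** The translated curve is [op (op a (c t))] applied to the curve
    [op (- c t) (c h)], which passes through the unit at time [t] with velocity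
    the Maurer-Cartan form of [c' t]. *)
Lemma is_derive_translate (a : V) (c : R -> V) (t : R) (c' : V) :
  is_derive t 1 c c' ->
  is_derive t 1 (fun h => op a (c h))
    ('D_(maurer_cartan (c t) c') (op (op a (c t))) 0).
Proof.
move=> dc.
have := op_is_derive (op a (c t)) (op_is_derive (- c t) dc).
rewrite gg_opNx; congr is_derive; apply/funext => h.
by rewrite -gg_opA opVK.
Qed.

(** In particular the differential at [0] of a left translation is onto, hence
    the left invariant fields form a basis at each point. *)
Lemma maurer_cartanK x tau : 'D_(maurer_cartan x tau) (op x) 0 = tau.
Proof.
have dl := is_derive_line x tau.
have [_] := is_derive_translate 0 dl; rewrite gg_op0x scale0r addr0 => <-.
rewrite (_ : (fun h => _) = (fun h : R => x + h *: tau)); first by case: dl.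
by apply/funext => h; rewrite gg_op0x.
Qed.

Lemma maurer_cartan_cvg (T : Type) (F : set_system T) {FF : Filter F}
    (f g : T -> V) (x v : V) : f @ F --> x -> g @ F --> v ->
  maurer_cartan (f t) (g t) @[t --> F] --> maurer_cartan x v.
Proof. by move=> fx gv; apply: op_derive_cvg => //; apply: cvgN. Qed.

End GradedGroup.

(** * Degrees and layers *)

Section Degrees.
Context (R : realType) (n : nat) (G : gradedGroup R n).
Local Notation V := 'rV[R]_n.
Local Notation step := (gg_step G).

Lemma layer_offset_step : layer_offset G step = n.
Proof.
have /directvP/= := gg_layer_direct G.
rewrite gg_layer_sum dimvf /dim /= mul1n => E; rewrite [RHS]E.
rewrite big_ord_recl gg_layer_eq0 // dimv0 add0n /layer_offset big_add1 /=.
by rewrite big_mkord.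
Qed.

Lemma layer_offsetS k :
  layer_offset G k.+1 = (layer_offset G k + \dim (gg_layer G k.+1))%N.
Proof. by rewrite /layer_offset big_nat_recr. Qed.

Variable e : n.-tuple V.
Hypothesis he : graded_basis G e.

(** The layers cut the [n] indices of the basis into consecutive blocks, whose
    dimensions add up to [n]; [e_j] belongs to the block that contains [j]. *)
Lemma graded_basis_layer (j : 'I_n) :
  exists k : 'I_step.+1, tnth e j \in gg_layer G k.
Proof.
have [k] : exists k, (k <= step)%N && (j < layer_offset G k)%N.
  by exists step; rewrite leqnn layer_offset_step ltn_ord.
elim: k => [|k ih].
  by rewrite /layer_offset big_geq // ltn0 andbF.
move=> /andP[ks jk]; have [jk'|jk'] := ltnP j (layer_offset G k).
  by apply: ih; rewrite (ltnW ks).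
have [_ /(_ k.+1 ks) /= bk] := he.
rewrite -ltnS in ks; exists (Ordinal ks) => /=.
have jd : (j - layer_offset G k < \dim (gg_layer G k.+1))%N.
  by rewrite ltn_subLR // -layer_offsetS.
apply: (basis_mem bk); rewrite (tnth_nth 0) -{1}(subnKC jk').
rewrite -nth_drop -(nth_take _ jd); apply: mem_nth.
have /eqP := size_basis (X := in_tuple _) bk.
by rewrite eqn_leq => /andP[+ _]; exact: leq_trans.
Qed.

Lemma basis_degree_lt j : (basis_degree G e j < step.+1)%N.
Proof. by rewrite ltnS; apply/bigmax_leqP => k _; rewrite -ltnS. Qed.

Lemma basis_degree_layer j : tnth e j \in gg_layer G (basis_degree G e j).
Proof.
have [k ek] := graded_basis_layer j.
rewrite /basis_degree.
have [|i ei ->] := @eq_bigmax_cond _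
  [pred k : 'I_step.+1 | tnth e j \in gg_layer G k]
  (fun k : 'I_step.+1 => k : nat); last exact: ei.
by apply/card_gt0P; exists k.
Qed.

Lemma graded_basis_expand v : v = \sum_(j < n) coord e j v *: tnth e j.
Proof.
have [b _] := he; rewrite {1}(coord_basis b (memvf v)).
by apply: eq_bigr => j _; rewrite (tnth_nth 0).
Qed.

(** The differential of the left translation by [x] maps [e_j] to [X_j(x)] and
    the Maurer-Cartan form of [tau] to [tau].  The [X_j(x)] span the space, as
    this differential is onto, so they are free. *)
Lemma field_coordE x tau j :
  field_coord G e x tau j = coord e j (maurer_cartan G x tau).
Proof.
pose X := [tuple left_invariant_field G e k x | k < n].
have E v : 'D_v (gg_op G x) 0 = \sum_(k < n) coord e k v *: X`_k.
  have dl := op_derive_linear G x 0.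
  rewrite [v in LHS](graded_basis_expand v).
  have S (r : seq 'I_n) :
      'D_(\sum_(k <- r) coord e k v *: tnth e k) (gg_op G x) 0 =
      \sum_(k <- r) coord e k v *: X`_k.
    elim: r => [|k r ih]; first by rewrite !big_nil (linear_fun0 dl).
    by rewrite !big_cons dl ih -tnth_nth tnth_mktuple.
  exact: S.
have Xfree : free X.
  have : basis_of fullv X.
    rewrite basisEdim size_tuple dimvf /dim /= mul1n leqnn andbT.
    apply/subvP => v _; rewrite -(maurer_cartanK G x v) E.
    apply: memv_suml => k _; apply: memvZ; apply: memv_span.
    by apply: mem_nth; rewrite size_tuple.
  exact: basis_free.
by rewrite /field_coord -/X -{1}(maurer_cartanK G x tau) E coord_sum_free.
Qed.

(** By the previous lemma only vectors [e_j] of degree at most the degree of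
    [tau] occur in the Maurer-Cartan form. *)
Lemma vector_degree_proj x tau (l : 'I_step.+1) :
  (vector_degree G e x tau < l)%N ->
  layer_proj l (maurer_cartan G x tau) = 0.
Proof.
move=> dl; set w := maurer_cartan G x tau.
have pl := layer_proj_linear l.
rewrite (graded_basis_expand w).
apply: (big_ind (fun v => layer_proj l v = 0)); first exact: linear_fun0.
  by move=> u v u0 v0; rewrite -[u]scale1r pl u0 v0 scaler0 addr0.
move=> j _; rewrite (linear_funZ pl).
have [->|wj] := eqVneq (coord e j w) 0; first by rewrite scale0r.
have ej : tnth e j \in gg_layer G (Ordinal (basis_degree_lt j)).
  exact: basis_degree_layer.
rewrite (layer_proj_id _ ej) -val_eqE /= gtn_eqF ?scaler0 //.
apply: leq_ltn_trans dl.
by apply: (leq_bigmax_cond (F := basis_degree G e)); rewrite field_coordE.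
Qed.

Lemma vector_degreeZ x tau k : k != 0 ->
  vector_degree G e x (k *: tau) = vector_degree G e x tau.
Proof.
move=> k0; apply: eq_bigl => j.
by rewrite /field_coord linearZ /= mulf_eq0 negb_or k0.
Qed.

Lemma vector_degree_le x tau : (vector_degree G e x tau <= step)%N.
Proof. by apply/bigmax_leqP => j _; rewrite -ltnS basis_degree_lt. Qed.

Lemma pointwise_degree_le (Sigma : set V) x : Sigma x ->
  (pointwise_degree G e Sigma x <= degree G e Sigma)%N.
Proof.
move=> Sx; have ks : (pointwise_degree G e Sigma x < step.+1)%N.
  by rewrite ltnS; exact: vector_degree_le.
apply: (@leq_bigmax_cond _ _ (fun k : 'I_step.+1 => k : nat) (Ordinal ks)).
by apply/asboolP; exists x.
Qed.

End Degrees.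

(** * A priori bound for curves with small velocity *)

Section SmallVelocity.
Context (R : realType) (n : nat).
Local Notation V := 'rV[R]_n.

Lemma coord_le_norm (x : V) i : `|x 0 i| <= `|x|.
Proof.
rewrite [leRHS]/Num.Def.normr/= mx_normrE.
exact: (le_bigmax _ (fun k : 'I_1 * 'I_n => `|x k.1 k.2|) (0, i)).
Qed.

Lemma norm_le_coord (x : V) m : 0 <= m -> (forall i, `|x 0 i| <= m) ->
  `|x| <= m.
Proof.
move=> m0 xm; rewrite [leLHS]/Num.Def.normr/= mx_normrE.
by apply: bigmax_le => // -[i j] _ /=; rewrite ord1.
Qed.

Lemma is_derive_coord (f : R -> V) (t : R) f' i : is_derive t 1 f f' ->
  is_derive t 1 (fun h => f h 0 i) (f' 0 i).
Proof.
move=> [df <-]; apply: DeriveDef; first by have /derivable_mxP := df.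
by rewrite (derive_mx df) mxE.
Qed.

Variables (f f' : R -> V) (s t kappa theta : R).
Hypothesis st : s <= t.
Hypothesis theta0 : 0 <= theta.
Hypothesis theta_kappa : theta < kappa.
Hypothesis fs0 : f s = 0.
Hypothesis df : forall u, s <= u <= t -> is_derive u 1 f (f' u).
Hypothesis f'_small : forall u, s <= u <= t -> `|f u| < kappa ->
  (t - s) * `|f' u| <= theta.

(* As long as [f] stays below [kappa], its speed is controlled and the mean
   value theorem applies to its coordinates. *)
Let small_until m : s <= m <= t -> (forall u, s <= u < m -> `|f u| < kappa) ->
  `|f m| <= theta.
Proof.
move=> /andP[sm mt] fk; apply: norm_le_coord => // i.
move: sm; rewrite le_eqVlt => /predU1P[<-|sm]; first by rewrite fs0 mxE normr0.
have dfi u : s <= u <= t -> is_derive u 1 (fun h => f h 0 i) (f' u 0 i).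
  by move=> /df; exact: is_derive_coord.
have [u||c] := @MVT R (fun h => f h 0 i) (fun u => f' u 0 i) s m sm.
- rewrite in_itv /= => /andP[su um]; apply: dfi.
  by rewrite (ltW su) (ltW (lt_le_trans um mt)).
- apply: derivable_within_continuous => u; rewrite in_itv /= => /andP[su um].
  by have [] := dfi u _; rewrite // su (le_trans um mt).
rewrite in_itv /= => /andP[sc cm]; rewrite fs0 mxE subr0 => ->.
have ct : s <= c <= t by rewrite (ltW sc) (ltW (lt_le_trans cm mt)).
have : `|f c| < kappa by apply: fk; rewrite (ltW sc).
move=> /(f'_small ct); apply: le_trans.
rewrite normrM mulrC ler_pM // ?coord_le_norm //.
by rewrite ger0_norm ?subr_ge0 ?(ltW sm) // lerD2r.
Qed.

(** The bound on the velocity [f'] is only assumed while [f] is small.  If [f]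
    reached the norm [kappa], then at the first such time [m] the bound
    [theta < kappa] would still hold, by continuity beyond [m] as well. *)
Lemma small_velocity : `|f t| <= theta.
Proof.
apply: small_until; first by rewrite st lexx.
apply: contrapT => /existsNP[u0 /not_implyP[/andP[su0 u0t] /negP fu0]].
rewrite -leNgt in fu0.
pose A := [set u | s <= u <= t /\ kappa <= `|f u|].
have Au0 : A u0 by split=> //; rewrite su0 ltW.
have lbA : lbound A s by move=> u [/andP[]].
have hA : has_inf A by split; [exists u0|exists s].
pose m := inf A.
have sm : s <= m by apply: lb_le_inf => //; exists u0.
have mt : m <= t.
  by apply: (le_trans _ (ltW u0t)); apply: inf_lbound => //; exists s.
have fm : `|f m| <= theta.
  apply: small_until; first by rewrite sm mt.
  move=> u /andP[su um]; rewrite ltNge; apply/negP => fu.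
  have : A u by split=> //; rewrite su (ltW (lt_le_trans um mt)).
  by move=> /(inf_lbound hA.2); rewrite leNgt um.
have fc : f u @[u --> m] --> f m.
  by apply: is_derive_continuous (df _); rewrite sm mt.
have : \forall u \near m, `|f u| < kappa.
  have /cvgr_lt : `|f u| @[u --> m] --> `|f m| by exact: cvg_norm.
  by apply; exact: le_lt_trans theta_kappa.
move=> /nbhs_ballP[d /= d0 dk].
have [a [/andP[sa at_] ka] am] := inf_adherent d0 hA.
have ma : m <= a by apply: inf_lbound => //; [exists s|split=> //; rewrite sa].
have := dk a; rewrite ltNge ka; apply/not_implyP; split => //.
by rewrite /ball /= ltr_distlC; rewrite (lt_le_trans _ ma) ?am // ltrBlDr ltrDl.
Qed.

End SmallVelocity.

(** * Short chords issued from points of low degree *)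

Section Chords.
Context (R : realType) (n : nat) (G : gradedGroup R n).
Local Notation V := 'rV[R]_n.
Local Notation op := (gg_op G).
Local Notation step := (gg_step G).

(** Continuity at [(0, 0)] of the differential, made homogeneous by its
    linearity in [v]. *)
Lemma translation_bound : exists2 kappa : R, 0 < kappa &
  forall a v : V, `|a| < kappa -> `|'D_v (op a) 0| <= kappa^-1 * `|v|.
Proof.
have D0 : 'D_0 (op 0) 0 = 0 by exact: derive0.
have : 'D_p.2 (op p.1) 0 @[p --> ((0, 0) : V * V)] --> ('D_0 (op 0) 0 : V).
  apply: op_derive_cvg; [exact: cvg_fst|exact: cvg_cst|exact: cvg_snd].
rewrite D0 => /cvgr0_norm_lt/(_ _ ltr01)/nbhs_ballP[k /= k0 kT].
exists (k / 2); first by rewrite divr_gt0.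
move=> a v av; have dl := op_derive_linear G a 0.
have [->|v0] := eqVneq v 0; first by rewrite (linear_fun0 dl) !normr0 mulr0.
have vp : 0 < `|v| by rewrite normr_gt0.
have c0 : 0 < (k / 2) * `|v|^-1 by rewrite !(mulr_gt0, divr_gt0, invr_gt0).
have : `|'D_(((k / 2) * `|v|^-1) *: v) (op a) 0| < 1.
  apply: (kT (a, _)); split => /=; rewrite -ball_normE /= sub0r normrN.
    by rewrite (lt_trans av) // ltr_pdivrMr // ltr_pMr // ltrDl.
  rewrite normrZ gtr0_norm // divfK ?gt_eqF //.
  by rewrite ltr_pdivrMr // ltr_pMr // ltrDl.
rewrite (linear_funZ dl) normrZ gtr0_norm // => /ltW.
by rewrite -ler_pdivlMl // mulr1 invfM invrK.
Qed.

(** The curve [z u], the dilation of [op (- c s) (c u)], starts from [0] and has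
    velocity ['D_w (op (z u)) 0], where [w] is the dilation of the
    Maurer-Cartan form of [c' u].  While [z u] is smaller than [kappa] this is
    at most [kappa^-1 * `|w|], which closes the bootstrap. *)
Lemma velocity_bound (c c' : R -> V) (s t r kappa theta : R) :
  (forall a v : V, `|a| < kappa -> `|'D_v (op a) 0| <= kappa^-1 * `|v|) ->
  0 <= theta < kappa -> s <= t ->
  (forall u, s <= u <= t -> is_derive u 1 c (c' u)) ->
  (forall u, s <= u <= t ->
    (t - s) * `|dilation G r (maurer_cartan G (c u) (c' u))| <= kappa * theta) ->
  `|dilation G r (op (- c s) (c t))| <= theta.
Proof.
move=> Tk /andP[th0 thk] st dc small.
have k0 : 0 < kappa by exact: le_lt_trans thk.
pose y u := op (- c s) (c u).
apply: (@small_velocity _ _ (fun u => dilation G r (y u))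
  (fun u => dilation G r ('D_(maurer_cartan G (c u) (c' u)) (op (y u)) 0))
  s t kappa) => //.
- by rewrite /y gg_opNx linear_fun0 //; exact: dilation_linear.
- move=> u su; apply: (is_derive_linear (dilation_linear G r)).
  exact: is_derive_translate (dc u su).
move=> u su yk; rewrite dilation_derive (linear_fun0 (dilation_linear G r)).
apply: (@le_trans _ _ (kappa^-1 * (kappa * theta))); last first.
  by rewrite mulrA mulVf ?mul1r // gt_eqF.
rewrite (le_trans _ (ler_wpM2l _ (small u su))) ?invr_ge0 ?(ltW k0) //.
rewrite mulrCA ler_wpM2l ?subr_ge0 //; exact: Tk.
Qed.

(** The dilation by [rho^-1] multiplies the layer [l] by [rho ^- l], so over a
    time [rho ^+ q] this layer contributes [rho ^+ (q - l)] times its norm.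
    The layers below [q] gain a factor [rho]; the layer [q], which vanishes at
    [s], is small by continuity; the layers above [q] vanish.  The constant
    [delta] depends on [s0] but not on [s], so that the estimate is locally
    uniform. *)
Lemma low_degree_velocity (lam : R -> V) (s0 : R) (q : nat) (eta : R) :
  (0 < q)%N -> 0 < eta -> lam u @[u --> s0] --> lam s0 ->
  (\forall u \near s0, forall l : 'I_step.+1, (q < l)%N ->
    layer_proj l (lam u) = 0) ->
  exists2 delta : R, 0 < delta & forall s u rho : R,
    `|s - s0| < delta -> 0 < rho < delta -> s <= u -> u - s <= rho ^+ q ->
    (forall l : 'I_step.+1, (q <= l)%N -> layer_proj l (lam s) = 0) ->
    rho ^+ q * `|dilation G rho^-1 (lam u)| <= eta.
Proof.
move=> q0 eta0 lamc high.
(* Each of the [step.+1] layers is allowed an equal share of [eta]. *)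
pose eta' := eta / step.+1%:R.
have eta'0 : 0 < eta' by rewrite divr_gt0.
(* The bound [1] is for the layers below [q], the other one for the layer [q],
   where it is used at both [s] and [u]. *)
pose zeta := Order.min 1 (eta' / 2).
have zeta0 : 0 < zeta by rewrite lt_min ltr01 divr_gt0.
pose M := \sum_(l < step.+1) `|layer_proj l (lam s0)|.
have M0 : 0 <= M by apply: sumr_ge0.
have near_s0 : \forall u \near s0, forall l : 'I_step.+1,
    `|layer_proj l (lam u) - layer_proj l (lam s0)| < zeta.
  apply: (@filter_forall _ _ (fun (l : 'I_step.+1) u =>
    `|layer_proj l (lam u) - layer_proj l (lam s0)| < zeta) (nbhs s0) _) => l.
  have : layer_proj l (lam u) @[u --> s0] --> layer_proj l (lam s0).
    by apply: cvg_linear => //; exact: layer_proj_linear.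
  by move=> /cvgr_distC_lt/(_ _ zeta0).
have /nbhs_ballP[d /= d0 dP] : \forall u \near s0,
    (forall l : 'I_step.+1, (q < l)%N -> layer_proj l (lam u) = 0) /\
    forall l : 'I_step.+1, `|layer_proj l (lam u) - layer_proj l (lam s0)| < zeta.
  exact: filterI.
exists (Order.min (Order.min 1 (d / 2)) (eta' / (M + 1))).
  by rewrite !lt_min ltr01 !divr_gt0 // ltr_wpDl.
move=> s u rho; rewrite !lt_min => /andP[/andP[_ ss0] _].
move=> /andP[rho0 /andP[/andP[rho1 rhod] rhoM]] su us low.
have rhoq : rho ^+ q <= rho.
  by rewrite -[leRHS]expr1 ler_wiXn2l // ltW.
have [hs cs] : (forall l : 'I_step.+1, (q < l)%N -> layer_proj l (lam s) = 0) /\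
    forall l : 'I_step.+1, `|layer_proj l (lam s) - layer_proj l (lam s0)| < zeta.
  apply: dP; rewrite /ball /= distrC (lt_trans ss0) //.
  by rewrite ltr_pdivrMr // ltr_pMr // ltrDl.
have [hu cu] : (forall l : 'I_step.+1, (q < l)%N -> layer_proj l (lam u) = 0) /\
    forall l : 'I_step.+1, `|layer_proj l (lam u) - layer_proj l (lam s0)| < zeta.
  apply: dP; rewrite /ball /= distrC -(subrKA s) (le_lt_trans (ler_normD _ _)) //.
  rewrite (splitr d) ltrD // ger0_norm ?subr_ge0 //.
  by rewrite (le_lt_trans us) // (le_lt_trans rhoq).
rewrite dilationE.
apply: (@le_trans _ _ (\sum_(l < step.+1) eta')); last first.
  by rewrite sumr_const card_ord -mulr_natr divfK ?pnatr_eq0.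
rewrite -[rho ^+ q]gtr0_norm ?exprn_gt0 // -normrZ scaler_sumr.
apply: (le_trans (ler_norm_sum _ _ _)); apply: ler_sum => l _.
rewrite scalerA normrZ gtr0_norm ?mulr_gt0 ?exprn_gt0 ?invr_gt0 //.
have [lq|ql|ql] := ltngtP (l : nat) q.
- apply: (@le_trans _ _ (rho * (M + 1))); last first.
    by rewrite -ler_pdivlMr ?ltr_wpDl // ltW.
  apply: ler_pM => //.
  + by rewrite mulr_ge0 // exprn_ge0 // ?invr_ge0 ltW.
  + rewrite exprVn -expfB // -(subnSK lq) exprS ler_piMr ?exprn_ile1 // ltW //.
  + rewrite -[layer_proj l (lam u)](subrK (layer_proj l (lam s0))).
    rewrite (le_trans (ler_normD _ _)) // addrC lerD //.
      by rewrite /M (bigD1 l) //= lerDl sumr_ge0.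
    by rewrite (le_trans (ltW (cu l))) // /zeta ge_min lexx.
- by rewrite hu // normr0 mulr0 ltW.
- rewrite ql exprVn mulfV ?mul1r; last by rewrite expf_neq0 // gt_eqF.
  have := low l; rewrite ql leqnn => /(_ isT) lows.
  have := cs l; rewrite lows sub0r normrN => cs0.
  rewrite -[layer_proj l (lam u)](subrK (layer_proj l (lam s0))).
  rewrite (le_trans (ler_normD _ _)) // (splitr eta') lerD //.
    by rewrite (le_trans (ltW (cu l))) // /zeta ge_min lexx orbT.
  by rewrite (le_trans (ltW cs0)) // /zeta ge_min lexx orbT.
Qed.

Variable d : V -> V -> R.
Hypothesis hd : homogeneous_distance G d.

Lemma distance_near0 (eps : R) : 0 < eps ->
  exists2 theta : R, 0 < theta & forall z : V, `|z| <= theta -> d 0 z <= eps.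
Proof.
move=> eps0.
have : d 0 z @[z --> (0 : V)] --> d 0 0.
  have zc : ((0 : V), z) @[z --> (0 : V)] --> ((0, 0) : V * V).
    by apply: (@cvg_pair _ _ _ (nbhs (0 : V)) (nbhs (0 : V)) (nbhs (0 : V))
      _ _ _ (fun=> 0) id); [exact: cvg_cst|exact: cvg_id].
  exact: (@continuous_cvg _ _ _ (nbhs (0 : V)) _ (fun z : V => ((0 : V), z))
    (fun p : V * V => d p.1 p.2) (0, 0) (@hd_continuous _ _ _ _ hd (0, 0)) zc).
have -> : d 0 0 = 0 by exact/(hd_eq0 hd).
move=> /cvgr0_norm_lt/(_ _ eps0)/nbhs_ballP[r /= r0 rd].
exists (r / 2); first by rewrite divr_gt0.
move=> z zr; apply: (le_trans (ler_norm _)); apply/ltW/rd.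
rewrite -ball_normE /= sub0r normrN (le_lt_trans zr) //.
by rewrite ltr_pdivrMr // ltr_pMr // ltrDl.
Qed.

(** Left invariance moves [x] to the unit, and homogeneity rescales. *)
Lemma distance_dilation x y rho : 0 < rho ->
  d x y = rho * d 0 (dilation G rho^-1 (op (- x) y)).
Proof.
move=> rho0.
have := hd_homogeneous hd 0 (op (- x) y) (r := rho^-1).
rewrite invr_gt0 => /(_ rho0); rewrite (linear_fun0 (dilation_linear G _)) => ->.
by rewrite mulrA mulfV ?gt_eqF // mul1r -(gg_opNx G x) (hd_left_invariant hd).
Qed.

(** After rescaling by [rho^-1] the chord becomes a vector of small norm, by
    [velocity_bound] and [low_degree_velocity]; its distance to the unit is
    small by continuity of [d]. *)
Lemma low_degree_chord (c c' : R -> V) (s0 : R) (q : nat) (eps : R) :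
  (0 < q)%N -> 0 < eps ->
  (\forall u \near s0, is_derive (u : R) 1 c (c' u)) ->
  c' u @[u --> s0] --> c' s0 ->
  (\forall u \near s0, forall l : 'I_step.+1, (q < l)%N ->
    layer_proj l (maurer_cartan G (c u) (c' u)) = 0) ->
  exists2 delta : R, 0 < delta & forall s t rho : R,
    `|s - s0| < delta -> 0 < rho < delta -> s <= t -> t - s <= rho ^+ q ->
    (forall l : 'I_step.+1, (q <= l)%N ->
      layer_proj l (maurer_cartan G (c s) (c' s)) = 0) ->
    d (c s) (c t) <= eps * rho.
Proof.
move=> q0 eps0 dc cc' high.
have [kappa k0 Tk] := translation_bound.
have [theta0 th0 dth] := distance_near0 eps0.
pose theta := Order.min theta0 (kappa / 2).
have thp : 0 < theta by rewrite lt_min th0 divr_gt0.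
have thk : theta < kappa.
  by rewrite gt_min ltr_pdivrMr // ltr_pMr // ltrDl ltr01 orbT.
have cc : c u @[u --> s0] --> c s0.
  exact: is_derive_continuous (nbhs_singleton dc).
have [delta1 delta10 H] := low_degree_velocity q0 (mulr_gt0 k0 thp)
  (maurer_cartan_cvg cc cc') high.
have /nbhs_ballP[r /= r0 rdc] := dc.
exists (Order.min (Order.min 1 delta1) (r / 2)).
  by rewrite !lt_min ltr01 delta10 divr_gt0.
move=> s t rho; rewrite !lt_min => /andP[/andP[_ sd] sr].
move=> /andP[rho0 /andP[/andP[rho1 rhod] rhor]] st ts low.
have rhoq : rho ^+ q <= rho.
  by rewrite -[leRHS]expr1 ler_wiXn2l // ltW.
rewrite (distance_dilation _ _ rho0) mulrC ler_wpM2r ?(ltW rho0) //.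
apply: dth; apply: (@le_trans _ _ theta); last by rewrite ge_min lexx.
apply: (velocity_bound (c' := c') Tk) => //.
- by rewrite (ltW thp).
- move=> u /andP[su ut]; apply: rdc.
  rewrite /ball /= distrC -(subrKA s) (le_lt_trans (ler_normD _ _)) //.
  rewrite (splitr r) ltrD // ger0_norm ?subr_ge0 // (le_lt_trans _ rhor) //.
  by rewrite (le_trans _ rhoq) // (le_trans _ ts) // lerD2r.
move=> u /andP[su ut].
have us : u - s <= rho ^+ q by rewrite (le_trans _ ts) // lerD2r.
apply: le_trans (H s u rho sd _ su us low); last by rewrite rho0.
by rewrite ler_wpM2r.
Qed.

End Chords.

(** * Sets of Hausdorff measure zero *)

Section NullSets.
Context (R : realType) (T : Type) (d : T -> T -> R).
Local Open Scope ereal_scope.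

(** Stated with coverings rather than as a vanishing outer measure: choosing
    the coverings is all that countable unions require. *)
Definition hausdorff_null (s : R) (A : set T) : Prop :=
  forall delta eps : R, (0 < delta)%R -> (0 < eps)%R ->
  exists2 S : nat -> set T,
    A `<=` \bigcup_i S i /\ (forall i, diameter d (S i) <= delta%:E) &
    \sum_(0 <= i <oo) hausdorff_gauge d s (S i) <= eps%:E.

Lemma hausdorff_gauge_ge0 s A : 0 <= hausdorff_gauge d s A.
Proof. by rewrite /hausdorff_gauge; case: ifP => // _; exact: poweR_ge0. Qed.

Lemma diameter_set0 : diameter d set0 = -oo.
Proof.
rewrite /diameter (_ : [set _ | _ in _] = set0) ?ereal_sup0 //.
by apply/seteqP; split => // x [p []].
Qed.

Lemma hausdorff_null0 s : hausdorff_null s set0.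
Proof.
move=> delta eps delta0 eps0; exists (fun=> set0).
  by split=> // i; rewrite diameter_set0 leNye.
rewrite eseries0 ?lee_fin ?ltW // => i _ _.
by rewrite /hausdorff_gauge eqxx.
Qed.

Lemma hausdorff_null_subset s A B : A `<=` B ->
  hausdorff_null s B -> hausdorff_null s A.
Proof.
move=> AB nB delta eps d0 e0; have [S [BS dS] SE] := nB _ _ d0 e0.
by exists S => //; split => //; exact: subset_trans BS.
Qed.

Lemma hausdorff_null_measure s A : hausdorff_null s A ->
  hausdorff_measure d s A = 0.
Proof.
move=> nA.
have content0 delta : (0 < delta)%R -> hausdorff_content d s delta A = 0.
  move=> d0; apply/eqP; rewrite eq_le; apply/andP; split.
    apply/lee_addgt0Pr => eps e0; rewrite add0e.
    have [S AS SE] := nA _ _ d0 e0.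
    by apply: le_trans SE; apply: ereal_inf_lbound; exists S.
  apply: le_ereal_inf_tmp => _ [S _ <-].
  by apply: nneseries_ge0 => i _ _; exact: hausdorff_gauge_ge0.
apply/eqP; rewrite eq_le; apply/andP; split.
  by apply: ge_ereal_sup => _ [delta d0 <-]; rewrite content0.
by apply: ereal_sup_ubound; exists 1%R; rewrite /= ?content0.
Qed.

(** The [i]-th set is covered with total gauge [eps / 2 ^ i.+1], and the double
    sequence of coverings is enumerated by a bijection of [nat] with
    [nat * nat]. *)
Lemma hausdorff_null_bigcup s (A : nat -> set T) :
  (forall i, hausdorff_null s (A i)) -> hausdorff_null s (\bigcup_i A i).
Proof.
move=> nA delta eps d0 e0.
have en i : (0 < eps / (2 ^ i.+1)%:R)%R.
  by rewrite divr_gt0 // ltr0n expn_gt0.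
have [G PG] : {G : nat -> nat -> set T & forall i,
    (A i `<=` \bigcup_j G i j /\ forall j, diameter d (G i j) <= delta%:E) /\
    \sum_(0 <= j <oo) hausdorff_gauge d s (G i j) <= (eps / (2 ^ i.+1)%:R)%:E}.
  apply: (@choice _ _ (fun i G =>
    (A i `<=` \bigcup_j G j /\ forall j, diameter d (G j) <= delta%:E) /\
    \sum_(0 <= j <oo) hausdorff_gauge d s (G j) <= (eps / (2 ^ i.+1)%:R)%:E)).
  by move=> i; have [S] := nA i _ _ d0 (en i); exists S.
have /card_esym/ppcard_eqP[f] := card_nat2.
pose mu := hausdorff_gauge d s.
have mu0 X : 0 <= mu X by exact: hausdorff_gauge_ge0.
exists (uncurry G \o f); first split.
- move=> x [i _ /(PG i).1.1[j _ Gx]].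
  by exists (f^-1%FUN (i, j)) => //=; rewrite invK ?inE.
- by move=> i; rewrite /= /uncurry; case: (f i) => a b; exact: (PG a).1.2.
apply: (@le_trans _ _ (\sum_(i <oo) \sum_(j <oo) mu (G i j))); last first.
  apply: le_trans (epsilon_trick0 xpredT (ltW e0)).
  apply: lee_nneseries => [i _ _|i _]; first exact: nneseries_ge0.
  exact: (PG i).2.
rewrite [leRHS]nneseries_esumT; last by move=> i; exact: nneseries_ge0.
under [leRHS]eq_esum do rewrite nneseries_esumT //.
rewrite esum_esum // nneseries_esumT; last by move=> i; exact: mu0.
rewrite (@reindex_esum _ _ _ [set: nat] _ f) /=; last first.
  split=> //.
  - by move=> i _; exists (f^-1%FUN i) => //; rewrite invK ?inE.
by apply: le_esum => i _ /=; rewrite /uncurry; case: (f i).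
Qed.

End NullSets.

Section NullCurves.
Context (R : realType) (T : Type) (d : T -> T -> R).

Lemma hausdorff_gauge_le (q : nat) (r : R) (A : set T) : (forall x, d x x = 0) ->
  (forall x y, A x -> A y -> d x y <= r) ->
  0 <= r -> (hausdorff_gauge d q%:R A <= (r ^+ q)%:E)%E.
Proof.
move=> dxx dr r0; rewrite /hausdorff_gauge; case: ifPn => [_|/set0P[x Ax]].
  by rewrite lee_fin exprn_ge0.
have diam0 : (0 <= diameter d A)%E.
  by apply: ereal_sup_ubound; exists (x, x) => //=; rewrite dxx.
have diamr : (diameter d A <= r%:E)%E.
  by apply: ge_ereal_sup => _ [[y z] [/= Ay Az] <-]; rewrite lee_fin dr.
rewrite -powR_mulrn // -poweR_EFin.
by apply: gt0_ler_poweR => //; rewrite in_itv /= ?leey ?andbT ?lee_fin.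
Qed.

(** Cells of length [rho ^+ q] in the parameter have images of diameter at most
    [eps * rho].  There are at most [(b - a) / rho ^+ q + 1] of them, for a
    total gauge of at most [(b - a + 1) * eps ^+ q]. *)
Lemma hausdorff_null_curve (q : nat) (c : R -> T) (A : set R) (a b : R) :
  (forall x, d x x = 0) -> (forall x y, d x y = d y x) ->
  (0 < q)%N -> A `<=` `[a, b] -> a <= b ->
  (forall eps : R, 0 < eps -> exists2 delta : R, 0 < delta &
    forall rho s t, 0 < rho < delta -> A s -> A t -> s <= t ->
      t - s <= rho ^+ q -> d (c s) (c t) <= eps * rho) ->
  hausdorff_null d q%:R (c @` A).
Proof.
move=> dxx dC q0 Aab ab small delta eps delta0 eps0.
pose L := b - a + 1.
have L0 : 0 < L by rewrite ltr_wpDl // subr_ge0.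
(* Since [eps1 <= 1] and [0 < q], [L * eps1 ^+ q] is at most [L * eps1]. *)
pose eps1 := Order.min 1 (eps / L).
have e10 : 0 < eps1 by rewrite lt_min ltr01 divr_gt0.
have [rho0 rho00 close] := small _ e10.
pose rho := Order.min (Order.min 1 delta) (rho0 / 2).
have rhop : 0 < rho by rewrite !lt_min ltr01 delta0 divr_gt0.
have rho1 : rho <= 1 by rewrite !ge_min lexx.
have rhod : rho <= delta by rewrite !ge_min lexx orbT.
have rhor : rho < rho0.
  by rewrite gt_min ltr_pdivrMr // ltr_pMr // ltrDl ltr01 orbT.
have rq0 : 0 < rho ^+ q by rewrite exprn_gt0.
have rq1 : rho ^+ q <= 1 by rewrite exprn_ile1 // ltW.
have er0 : 0 <= eps1 * rho by rewrite mulr_ge0 // ltW.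
pose cell s := Num.truncn ((s - a) / rho ^+ q).
have cellP s : A s -> (cell s)%:R <= (s - a) / rho ^+ q < (cell s).+1%:R.
  move=> /Aab; rewrite /= in_itv /= => /andP[sa _].
  by apply: truncn_itv; rewrite divr_ge0 ?subr_ge0 // ltW.
pose S i := c @` [set s | A s /\ cell s = i].
have dS i x y : S i x -> S i y -> d x y <= eps1 * rho.
  move=> [s [As si] <-] [t [At ti] <-].
  wlog st : s t As At si ti / s <= t.
    by move=> H; have [/H|/ltW/H] := leP s t; [|rewrite dC]; apply.
  apply: close => //; first by rewrite rhop.
  have /andP[si1 _] := cellP _ As; have /andP[_ ti2] := cellP _ At.
  rewrite si in si1; rewrite ti -natr1 in ti2.
  rewrite ler_pdivlMr // in si1; rewrite ltr_pdivrMr // mulrDl mul1r in ti2.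
  lra.
exists S.
  split=> [_ [s As <-]|i]; first by exists (cell s) => //; exists s.
  apply: ge_ereal_sup => _ [[x y] [/= Sx Sy] <-]; rewrite lee_fin.
  apply: le_trans (dS i x y Sx Sy) _; apply: le_trans rhod.
  by rewrite ler_piMl ?(ltW rhop) // ge_min lexx.
pose N := (Num.truncn ((b - a) / rho ^+ q)).+1.
(* Only the first [N] cells meet the segment. *)
have SN i : (N <= i)%N -> S i = set0.
  move=> Ni; apply/seteqP; split=> // x [s [As si] _] /=.
  move: Ni; rewrite -si /N /cell ltnNge => /negP; apply.
  apply: le_truncn; rewrite ler_wpM2r ?invr_ge0 ?(ltW rq0) // lerD2r.
  by have /Aab := As; rewrite /= in_itv /= => /andP[].
rewrite (nneseries_split 0 N); last by move=> *; exact: hausdorff_gauge_ge0.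
rewrite add0n eseries0 ?adde0 => [|i Ni _]; last first.
  by rewrite SN // /hausdorff_gauge eqxx.
apply: (@le_trans _ _ (\sum_(0 <= k < N) ((eps1 * rho) ^+ q)%:E)%E).
  by apply: lee_sum => i _; apply: hausdorff_gauge_le => //; exact: dS.
rewrite sumEFin lee_fin sumr_const_nat subn0 -mulr_natl exprMn.
have Nle : N%:R * rho ^+ q <= L.
  rewrite /N -natr1 mulrDl mul1r lerD // -ler_pdivlMr //.
  by have /andP[] : (Num.truncn ((b - a) / rho ^+ q))%:R <= (b - a) / rho ^+ q
    < (Num.truncn ((b - a) / rho ^+ q)).+1%:R
    by apply: truncn_itv; rewrite divr_ge0 ?subr_ge0 // ltW.
rewrite mulrCA mulrC.
apply: (@le_trans _ _ (L * eps1)).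
  apply: ler_pM => //; [by rewrite mulr_ge0 // ltW|by rewrite exprn_ge0 // ltW|].
  by rewrite -[leRHS]expr1 ler_wiXn2l ?(ltW e10) // ge_min lexx.
by rewrite mulrC -ler_pdivlMr // ge_min lexx orbT.
Qed.

End NullCurves.

Section LocalToGlobal.
Context (R : realType) (n : nat).
Local Notation V := 'rV[R]_n.

Lemma rational_approximation (x : V) (r : R) : 0 < r ->
  exists p : 'rV[rat]_n, `|x - map_mx ratr p| < r.
Proof.
move=> r0; have r20 : 0 < r / 2 by rewrite divr_gt0.
have /fin_all_exists[p px] : forall j : 'I_n, exists y : rat,
    `|x 0 j - ratr y| <= r / 2.
  move=> j; have : x 0 j - r / 2 < x 0 j + r / 2.
    by rewrite ltrBlDr -addrA ltrDl addr_gt0.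
  move=> /rat_in_itvoo[y]; rewrite in_itv /= => /andP[h1 h2].
  exists y; rewrite ler_distlC; apply/andP; split; exact: ltW.
exists (\row_j p j); apply: (@le_lt_trans _ _ (r / 2)).
  by apply: norm_le_coord => [|j]; rewrite ?(ltW r20) // !mxE.
by rewrite ltr_pdivrMr // ltr_pMr // ltrDl.
Qed.

(** Lindelof: the space is covered by countably many balls with rational centre
    and radius [1 / k], and each point lies in such a ball that is contained in
    its given neighbourhood. *)
Lemma hausdorff_null_local (d : V -> V -> R) (s : R) (A : set V) :
  (forall x, A x -> exists2 N : set V, nbhs x N & hausdorff_null d s (A `&` N)) ->
  hausdorff_null d s A.
Proof.
move=> locA.
pose B (i : 'rV[rat]_n * nat) :=
  [set y : V | `|y - map_mx ratr i.1| < i.2.+1%:R^-1].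
pose F k := if unpickle k is Some i then
  (if `[< hausdorff_null d s (A `&` B i) >] then A `&` B i else set0) else set0.
apply: (@hausdorff_null_subset _ _ _ _ _ (\bigcup_k F k)); last first.
  apply: hausdorff_null_bigcup => k; rewrite /F.
  case: (unpickle k) => [i|]; last exact: hausdorff_null0.
  by case: asboolP => // _; exact: hausdorff_null0.
move=> x Ax; have [N /nbhs_ballP[r /= r0 rN] nN] := locA x Ax.
have [k kr] : exists k : nat, k.+1%:R^-1 < r / 2.
  have := near_infty_natSinv_lt (PosNum (divr_gt0 r0 (ltr0Sn R 1))).
  by move=> [k _ /(_ k (leqnn k))] /=; exists k.
have k0 : 0 < k.+1%:R^-1 :> R by rewrite invr_gt0.
have [p px] := rational_approximation x k0.
exists (pickle (p, k)) => //; rewrite /F pickleK.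
have BN : B (p, k) `<=` N.
  move=> y; rewrite /B /= => yp; apply: rN; rewrite -ball_normE /=.
  rewrite -(subrKA (map_mx ratr p)) (le_lt_trans (ler_normD _ _)) //.
  by rewrite (splitr r) ltrD // ?(lt_trans px) // distrC (lt_trans yp).
case: asboolP => [_|]; first by [].
case; apply: hausdorff_null_subset nN => y [Ay By]; split => //; exact: BN.
Qed.

End LocalToGlobal.

(** * Tangent lines of one-dimensional submanifolds *)

Section Curves.
Context (R : realType) (n : nat).
Local Notation V := 'rV[R]_n.

Lemma C1_on_is_derive (a b : R) (c : R -> V) t : C1_on a b c -> t \in `]a, b[%R ->
  is_derive t 1 c (derive1 c t).
Proof. by move=> cC /cC[dc _]; rewrite derive1E; exact: DeriveDef. Qed.

Lemma derive1_shift (c : R -> V) t :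
  derive1 (fun s => c (s + t)) = fun s => derive1 c (s + t).
Proof.
apply/funext => s; rewrite /derive1.
by under eq_fun do rewrite -addrA.
Qed.

(** The parametrization itself, shifted in time, is a curve in [Sigma] with
    this velocity. *)
Lemma velocity_tangent (Sigma U : set V) (a b : R) (c : R -> V) t :
  local_parametrization Sigma U a b c -> t \in `]a, b[%R ->
  tangent_space Sigma (c t) (derive1 c t).
Proof.
move=> [cC _ _ cS _]; rewrite in_itv /= => /andP[at_ tb].
pose eps := Order.min (t - a) (b - t).
have shift_in s : s \in `]- eps, eps[%R -> s + t \in `]a, b[%R.
  rewrite !in_itv /= ltrNl !lt_min => /andP[/andP[h1 _] /andP[_ h2]].
  by apply/andP; split; lra.
exists eps, (fun s => c (s + t)); split.
- by rewrite lt_min !subr_gt0 at_.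
- move=> s /shift_in/cC[dc cc]; split.
    move: dc; rewrite /derivable /=.
    by under eq_fun do rewrite addrA.
  rewrite derive1_shift.
  have st : u + t @[u --> s] --> s + t.
    by apply: cvgD; [exact: cvg_id|exact: cvg_cst].
  exact: (@continuous_cvg _ _ _ (nbhs s) _ (fun u => u + t) (derive1 c) (s + t)
    cc st).
- move=> s /shift_in st.
  have [] // : (Sigma `&` U) (c (s + t)) by rewrite -cS; exists (s + t).
- by rewrite add0r.
- by rewrite derive1_shift add0r.
Qed.

(** The difference quotient extended by [c'] at [t]: a factorization of
    [c u - c t] that is valid at [u = t] too. *)
Lemma difference_quotient (c : R -> V) (t : R) (c' : V) : is_derive t 1 c c' ->
  exists2 Q : R -> V, Q u @[u --> t] --> c' &
    forall u, c u - c t = (u - t) *: Q u.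
Proof.
move=> /is_deriveP dc.
pose Q0 h := if h == 0 then c' else h^-1 *: (c (h *: 1 + t) - c t).
have Q0c : Q0 h @[h --> (0 : R)] --> c'.
  apply/cvgrPdist_lt => e e0.
  move/cvgrPdist_lt : dc => /(_ _ e0); rewrite near_withinE.
  apply: filterS => h hP; rewrite /Q0; case: eqP => [_|/eqP/hP//].
  by rewrite subrr normr0.
exists (fun u => Q0 (u - t)).
  apply: (cvg_comp (fun u => u - t) Q0); last exact: Q0c.
  have : u - t @[u --> t] --> t - t.
    by apply: cvgB; [exact: cvg_id|exact: cvg_cst].
  by rewrite subrr.
move=> u; rewrite /Q0; case: eqP => [/eqP|/eqP ut].
  by rewrite subr_eq0 => /eqP ->; rewrite !subrr scale0r.
by rewrite scalerA mulfV // scale1r [_%:A]mulr1 subrK.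
Qed.

(** A curve [g] in [Sigma] through [c t] is, near time [0], of the form
    [c (p s)] with [p s] tending to [t], since [c] is a homeomorphism onto an
    open part of [Sigma].  Then [g s - g 0 = (p s - t) *: Q (p s)] is
    parallel to the difference quotient [Q (p s)], which tends to the velocity of [c];
    the identity passes to the limit after division by [s]. *)
Lemma tangent_parallel (Sigma U : set V) (a b : R) (c : R -> V) t tau :
  open U -> local_parametrization Sigma U a b c -> t \in `]a, b[%R ->
  tangent_space Sigma (c t) tau ->
  forall i j, tau 0 i * derive1 c t 0 j = tau 0 j * derive1 c t 0 i.
Proof.
move=> oU [cC _ cinj cS chomeo] tab [eps [g [eps0 gC gS g0 g'0]]] i j.
have Sct : (Sigma `&` U) (c t) by rewrite -cS; exists t.
have zero_in : (0 : R) \in `]- eps, eps[%R by rewrite in_itv /= oppr_lt0 eps0.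
have dg := C1_on_is_derive gC zero_in; rewrite g'0 in dg.
have gc : g s @[s --> (0 : R)] --> g 0 := is_derive_continuous dg.
have [Q Qc QE] := difference_quotient (C1_on_is_derive cC tab).
pose p s := xget t [set u | u \in `]a, b[%R /\ c u = g s].
have gSU (W : set V) : open W -> W (c t) ->
    \forall s \near (0 : R), (Sigma `&` U `&` W) (g s).
  move=> oW Wct.
  have nW : nbhs (g 0) (U `&` W).
    rewrite g0; apply: open_nbhs_nbhs; split; first exact: openI.
    by split=> //; case: Sct.
  have gnear : \forall s \near (0 : R), s \in `]- eps, eps[%R.
    exact: near_in_itvoo.
  near=> s; have [Us Ws] : (U `&` W) (g s) by near: s; exact: gc.
  by split => //; split => //; apply: gS; near: s.
have pE u s : u \in `]a, b[%R -> c u = g s -> p s = u.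
  move=> uab cu.
  have /(xgetPex t) : exists v, [set u | u \in `]a, b[%R /\ c u = g s] v.
    by exists u.
  by rewrite -/(p s) => -[pab cp]; apply: cinj => //; rewrite cp cu.
have pc : p s @[s --> (0 : R)] --> t.
  apply/cvgrPdist_lt => e e0.
  have [W oW WE] := chomeo (ball t e) (ball_open t e).
  have Wct : W (c t).
    have : (Sigma `&` U `&` W) (c t).
      by rewrite -WE; exists t => //; split=> //; exact: ballxx.
    by case.
  have := gSU W oW Wct; apply: filterS => s; rewrite -WE => -[u [uab ut] cu].
  by rewrite (pE u s).
have cp : \forall s \near (0 : R), c (p s) = g s.
  have := gSU setT openT I; apply: filterS => s [+ _].
  by rewrite -cS => -[u uab cu]; rewrite (pE u s).
have QpC : Q (p s) @[s --> (0 : R)^'] --> derive1 c t.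
  by apply: cvg_within_filter; exact: (cvg_comp p Q pc Qc).
have dg' := (is_deriveP _ _ _ _).1 dg.
have lim_ij k l : (s^-1 *: (g (s *: 1 + 0) - g 0)) 0 k * Q (p s) 0 l
    @[s --> (0 : R)^'] --> tau 0 k * derive1 c t 0 l.
  by apply: cvgM; exact: cvg_coord.
have cp' : \forall s \near (0 : R)^', c (p s) = g s by exact: cvg_within.
have lim_ji : (s^-1 *: (g (s *: 1 + 0) - g 0)) 0 i * Q (p s) 0 j
    @[s --> (0 : R)^'] --> tau 0 j * derive1 c t 0 i.
  apply: cvg_trans (lim_ij j i); apply: near_eq_cvg; near=> s.
  have gs : c (p s) = g s by near: s.
  by rewrite [_%:A]mulr1 addr0 g0 -gs QE scalerA !mxE mulrAC.
exact: (cvg_unique (@Rhausdorff R) (lim_ij i j) lim_ji).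
Unshelve. all: by end_near. Qed.

Lemma parallel_scalar (u v : V) : v != 0 ->
  (forall i j, u 0 i * v 0 j = u 0 j * v 0 i) -> exists k, u = k *: v.
Proof.
move=> v0 uv; have /existsP[j vj] : [exists j, v 0 j != 0].
  apply: contraNT v0 => /existsPn v0; apply/eqP/rowP => j; rewrite mxE.
  by apply/eqP/negbNE.
exists (u 0 j / v 0 j); apply/rowP => i; rewrite mxE.
by rewrite mulrAC -uv mulfK.
Qed.

(** The tangent vector chosen by the definition of the pointwise degree is a
    nonzero multiple of the velocity. *)
Lemma pointwise_degreeE (G : gradedGroup R n) (e : n.-tuple V)
    (Sigma U : set V) (a b : R) (c : R -> V) t :
  open U -> local_parametrization Sigma U a b c -> t \in `]a, b[%R ->
  pointwise_degree G e Sigma (c t) = vector_degree G e (c t) (derive1 c t).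
Proof.
move=> oU cP tab; have c'0 : derive1 c t != 0 by have [_ /(_ _ tab)] := cP.
have /(xgetPex 0) : exists tau,
    [set tau | tangent_space Sigma (c t) tau /\ tau != 0] tau.
  by exists (derive1 c t); split=> //; exact: velocity_tangent cP tab.
rewrite /pointwise_degree; move: (xget _ _) => tau [tau_tangent tau0].
have [k tauE] := parallel_scalar c'0 (tangent_parallel oU cP tab tau_tangent).
rewrite tauE vector_degreeZ //; apply: contraNneq tau0 => k0.
by rewrite tauE k0 scale0r.
Qed.

End Curves.

(** * Negligibility *)

Section Negligibility.
Context (R : realType) (n : nat) (G : gradedGroup R n).
Local Notation V := 'rV[R]_n.
Variable e : n.-tuple V.
Hypothesis he : graded_basis G e.
Variable d : V -> V -> R.
Hypothesis hd : homogeneous_distance G d.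

(** A segment being compact, the locally uniform estimates [low_degree_chord]
    hold uniformly on it. *)
Lemma low_degree_chord_segment (c c' : R -> V) (a b : R) (q : nat) (eps : R) :
  (0 < q)%N -> 0 < eps ->
  (forall s0, s0 \in `[a, b]%R ->
    [/\ \forall u \near s0, is_derive (u : R) 1 c (c' u),
    c' u @[u --> s0] --> c' s0 &
    \forall u \near s0, forall l : 'I_(gg_step G).+1, (q < l)%N ->
      layer_proj l (maurer_cartan G (c u) (c' u)) = 0]) ->
  exists2 delta : R, 0 < delta & forall rho s t : R,
    0 < rho < delta -> s \in `[a, b]%R -> s <= t -> t - s <= rho ^+ q ->
    (forall l : 'I_(gg_step G).+1, (q <= l)%N ->
      layer_proj l (maurer_cartan G (c s) (c' s)) = 0) ->
    d (c s) (c t) <= eps * rho.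
Proof.
move=> q0 eps0 cP.
pose P rho s := forall t, s <= t -> t - s <= rho ^+ q ->
  (forall l : 'I_(gg_step G).+1, (q <= l)%N ->
      layer_proj l (maurer_cartan G (c s) (c' s)) = 0) ->
    d (c s) (c t) <= eps * rho.
have : \forall rho \near (0 : R)^'+, `[a, b] `<=` P rho.
  apply: (compact_near_coveringP _).1; first exact: segment_compact.
  move=> s0 s0ab; have [dc cc' high] := cP s0 s0ab.
  have [delta delta0 H] := low_degree_chord hd q0 eps0 dc cc' high.
  exists ([set s | `|s - s0| < delta], [set rho | 0 < rho < delta]) => /=.
    split; apply/nbhs_ballP; exists delta => //= u.
      by rewrite -ball_normE /= distrC.
    rewrite -ball_normE /= sub0r normrN => ud u0.
    by rewrite u0 /= -(gtr0_norm u0).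
  by move=> [s rho] /= [sd rd] t; exact: H.
move=> /nbhs_ballP[delta /= delta0 dP].
exists delta => // rho s t /andP[rho0 rhod] sab st ts.
apply: (dP rho) => //=.
by rewrite -ball_normE /= sub0r normrN gtr0_norm.
Qed.

(** A neighbourhood of [c t] in [Sigma] is the image of an open interval whose
    closure is still in the domain of the chart; on this closure the chord
    estimate applies to all the points of low degree. *)
Lemma low_degree_null_local (Sigma U : set V) (a b : R) (c : R -> V) t
    (q := degree G e Sigma) :
  open U -> local_parametrization Sigma U a b c -> t \in `]a, b[%R ->
  exists2 N : set V, nbhs (c t) N & hausdorff_null d q%:R
    ([set x | Sigma x /\ (pointwise_degree G e Sigma x < q)%N] `&` N).
Proof.
move=> oU cP tab; have [cC _ _ cS chomeo] := cP.
have degE s : s \in `]a, b[%R ->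
    pointwise_degree G e Sigma (c s) = vector_degree G e (c s) (derive1 c s).
  by move=> sab; exact: pointwise_degreeE cP sab.
have cSigma s : s \in `]a, b[%R -> Sigma (c s).
  move=> sab; suff [] : (Sigma `&` U) (c s) by [].
  by rewrite -cS; exists s.
move: (tab); rewrite in_itv /= => /andP[at_ tb].
pose a' := (a + t) / 2; pose b' := (t + b) / 2.
have [W oW WE] := chomeo `]a', b'[%classic (itv_open _ _).
have ab'_in s : s \in `[a', b']%R -> s \in `]a, b[%R.
  by rewrite !in_itv /= /a' /b' => /andP[h1 h2]; apply/andP; split; lra.
have a'b' : a' <= b' by rewrite /a' /b'; lra.
have ct : (Sigma `&` U `&` W) (c t).
  rewrite -WE; exists t => //; split => //.
  by rewrite /= in_itv /= /a' /b'; apply/andP; split; lra.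
exists (U `&` W).
  by apply: open_nbhs_nbhs; split; [exact: openI|case: ct => [[]]].
have [q0|q0] := posnP q.
  (* No point has a degree below [q = 0]. *)
  apply: hausdorff_null_subset (hausdorff_null0 d _) => x [[_]].
  by rewrite q0.
pose A := [set s | s \in `[a', b']%R /\ (pointwise_degree G e Sigma (c s) < q)%N].
apply: (@hausdorff_null_subset _ _ _ _ _ (c @` A)).
  move=> x [[Sx xq] [Ux Wx]].
  have : (Sigma `&` U `&` W) x by [].
  rewrite -WE => -[s [sab sab'] cs]; exists s => //; split; last by rewrite cs.
  by apply: subset_itv_oo_cc.
apply: (@hausdorff_null_curve _ _ _ _ _ _ a' b') => //.
- by move=> x; exact/(hd_eq0 hd).
- exact: hd_sym hd.
- by move=> s [].
move=> eps eps0.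
have [s0 s0ab|delta delta0 H] :=
  @low_degree_chord_segment c (derive1 c) a' b' q eps q0 eps0.
  have near_in : \forall u \near s0, u \in `]a, b[%R.
    by apply: near_in_itvoo; exact: ab'_in.
  split.
  - by apply: filterS near_in => u; exact: C1_on_is_derive.
  - by have [_] := cC s0 (ab'_in _ s0ab).
  - apply: filterS near_in => u uab l ql; apply: (vector_degree_proj he).
    rewrite -degE //; apply: leq_ltn_trans ql.
    by apply: pointwise_degree_le => //; exact: cSigma.
exists delta => // rho s u rhod [sab sq] _ su us; apply: (H rho s u) => // l ql.
apply: (vector_degree_proj he); rewrite -degE; last exact: ab'_in.
exact: leq_trans ql.
Qed.

End Negligibility.

Theorem theorem1p1 (R : realType) (n : nat) (G : gradedGroup R n)
    (e : n.-tuple 'rV[R]_n) (he : graded_basis G e)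
    (d : 'rV[R]_n -> 'rV[R]_n -> R) (hd : homogeneous_distance G d)
    (Sigma : set 'rV[R]_n) (hSigma : C1_submanifold1 Sigma) :
  let q := degree G e Sigma in
  hausdorff_measure d q%:R
    [set x | Sigma x /\ (pointwise_degree G e Sigma x < q)%N] = 0%E.
Proof.
move=> q; apply: hausdorff_null_measure.
apply: hausdorff_null_local => x [Sx _].
have [U [a [b [c [oU Ux ab cP]]]]] := hSigma x Sx.
have [_ _ _ cS _] := cP.
have : (Sigma `&` U) x by [].
by rewrite -cS => -[t tab <-]; exact: (low_degree_null_local he hd oU cP tab).
Qed.
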